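(* Let $G$ be an infinite Abelian group and $\{a_n\}_{n\in\mathbb{N}}$ a $T$-sequence in $G$. Then $P(G|\{a_n\})$ does not admit a $T_1$-complementary Hausdorff paratopological group topology on $G$; that is, writing $\tau$ for the topology of $P(G|\{a_n\})$, there is no Hausdorff paratopological group topology $\sigma$ on $G$ such that $\sigma$ and $\tau$ are $T_1$-complementary.
   Context: A paratopological group topology is a topology making the group operation jointly continuous; a group topology is a topology making $G$ a topological group. All these topologies are assumed $T_1$ (so group topologies are Hausdorff). A sequence $\{a_n\}$ in $G$ is a $T$-sequence if there is a group topology on $G$ in which $\{a_n\}$ converges to $0$. $P(G|\{a_n\})$ denotes $G$ endowed with the strongest (finest) paratopological group topology in which $\{a_n\}$ converges to $0$. Two $T_1$ topologies $\tau_1,\tau_2$ on a set $X$ are $T_1$-complementary if $\tau_1\cap\tau_2$ is the cofinite topology on $X$ and the topology generated by $\tau_1\cup\tau_2$ is discrete. *)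

(* Defs.v *)
From HB Require Import structures.
From mathcomp Require Import all_boot all_order all_algebra.
From mathcomp Require Import all_classical topology.

Set Implicit Arguments.
Unset Strict Implicit.
Unset Printing Implicit Defensive.

Import GRing.Theory.
Local Open Scope classical_set_scope.
Local Open Scope ring_scope.

(* [set0] is open as the union of the empty family. *)
Record is_topology (X : Type) (op : set_system X) : Prop := IsTopology {
  topT : op setT ;
  topI : setI_closed op ;
  top_bigU : forall (I : Type) (f : I -> set X),
    (forall i, op (f i)) -> op (\bigcup_i f i)
}.

(* Several topologies on one set have to be compared, so a topology is a
   value, not a canonical structure on [X]. *)
Record topology (X : Type) := Topology {
  opens : set_system X ;
  opens_topology : is_topology opens
}.

(* [X] carrying [tau] as its canonical topology: the library's notions
   ([continuous], [-->], [accessible_space], [hausdorff_space]) applied to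
   [with_topology tau] are relative to [tau]. *)
Definition with_topology (X : choiceType) (tau : topology X) : Type := X.

HB.instance Definition _ (X : choiceType) (tau : topology X) :=
  Choice.copy (with_topology tau) X.
HB.instance Definition _ (X : choiceType) (tau : topology X) :=
  isOpenTopological.Build (with_topology tau)
    (topT (opens_topology tau)) (topI (opens_topology tau))
    (top_bigU (opens_topology tau)).

(* [accessible_space] is the T1 axiom. *)
Definition is_T1 (X : choiceType) (tau : topology X) : Prop :=
  accessible_space (with_topology tau).

Definition is_hausdorff (X : choiceType) (tau : topology X) : Prop :=
  hausdorff_space (with_topology tau).

Definition add_is_continuous (G : zmodType) (tau : topology G) : Prop :=
  continuous ((fun p => (p.1 : G) + (p.2 : G)) :
    with_topology tau * with_topology tau -> with_topology tau).

Definition opp_is_continuous (G : zmodType) (tau : topology G) : Prop :=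
  continuous ((fun x => - (x : G)) : with_topology tau -> with_topology tau).

Definition converges_to (X : choiceType) (tau : topology X) (a : nat -> X)
    (l : X) : Prop :=
  (a : nat -> with_topology tau) @ \oo --> (l : with_topology tau).

(* T1 is part of the notion. *)
Definition paratopological_group_topology (G : zmodType) (tau : topology G)
    : Prop :=
  is_T1 tau /\ add_is_continuous tau.

Definition group_topology (G : zmodType) (tau : topology G) : Prop :=
  paratopological_group_topology tau /\ opp_is_continuous tau.

Definition T_sequence (G : zmodType) (a : nat -> G) : Prop :=
  exists tau : topology G, group_topology tau /\ converges_to tau a 0.

(* [tau] is the topology of P(G|{a_n}); the condition determines the open
   sets of [tau], and [P_topology_exists] below gives existence when [a] is
   a T-sequence. *)
Definition is_P_topology (G : zmodType) (a : nat -> G) (tau : topology G)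
    : Prop :=
  [/\ paratopological_group_topology tau, converges_to tau a 0 &
      forall tau' : topology G, paratopological_group_topology tau' ->
        converges_to tau' a 0 -> opens tau' `<=` opens tau].

Definition cofinite_opens (X : Type) : set_system X :=
  [set A | A = set0 \/ finite_set (~` A)].

Definition T1_complementary (X : choiceType) (tau1 tau2 : topology X) : Prop :=
  [/\ is_T1 tau1, is_T1 tau2, opens tau1 `&` opens tau2 = @cofinite_opens X &
      smallest (@is_topology X) (opens tau1 `|` opens tau2) = setT].

Lemma smallest_is_topology (X : Type) (B : set_system X) :
  is_topology (smallest (@is_topology X) B).
Proof.
split.
- by move=> M [tM _]; exact: topT.
- by move=> U V BU BV M MB; apply: (topI MB.1); [exact: BU|exact: BV].
- by move=> I f Bf M MB; apply: (top_bigU MB.1) => i; exact: Bf.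
Qed.

Lemma P_topology_exists (G : zmodType) (a : nat -> G) :
  T_sequence a -> exists tau : topology G, is_P_topology a tau.
Proof.
move=> [tau0 [[ptau0 _] cva0]].
pose B : set_system G := [set A | exists tau' : topology G,
  [/\ paratopological_group_topology tau', converges_to tau' a 0 &
      opens tau' A]].
pose tau := Topology (smallest_is_topology B).
have Btau A : B A -> opens tau A by exact: sub_gen_smallest.
have tau_nbhs (t : topology G) (x : G) (A : set G) :
    opens t `<=` opens tau ->
    nbhs (x : with_topology t) A -> nbhs (x : with_topology tau) A.
  move=> ttau; rewrite !nbhsE => -[U [oU Ux] UA].
  by exists U => //; split => //; exact: ttau.
exists tau; split; last by move=> t pt ct A tA; apply: Btau; exists t.
- split.
    move=> x y xy; have [A [oA xA yA]] := ptau0.1 x y xy.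
    by exists A; split => //; apply: Btau; exists tau0.
  apply/continuousP => A.
  pose T := with_topology tau.
  pose add := (fun p : T * T => (p.1 : G) + (p.2 : G)).
  pose C : set_system G := [set A | open (add @^-1` A)].
  suff: smallest (@is_topology G) B `<=` C by exact.
  apply: smallest_sub.
    split; rewrite /C.
    - by rewrite /= preimage_setT; exact: openT.
    - by move=> U V oU oV; rewrite /= preimage_setI; exact: openI.
    - by move=> I f oF; rewrite /= preimage_bigcup; apply: bigcup_open => i _; exact: oF.
  move=> U [t [[t1 tc] ct tU]]; rewrite /C /= openE => -[x y] Uxy.
  have ttau : opens t `<=` opens tau.
    by move=> V tV; apply: Btau; exists t; split.
  have nU : nbhs (x + y : with_topology t) U by apply: open_nbhs_nbhs; split.
  have [[P Q] /= [Px Qy] PQ] := tc (x, y) U nU.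
  by exists (P, Q) => //=; split; exact: (tau_nbhs t).
- move=> A; rewrite nbhsE => -[U [oU U0] UA].
  apply: (filterS UA) => {A UA}.
  pose C : set_system G := [set A | A 0 -> \forall n \near \oo, A (a n)].
  suff: smallest (@is_topology G) B `<=` C by move=> /(_ U oU) /(_ U0).
  apply: smallest_sub.
    split.
    - by move=> _; exact: filterT.
    - move=> V W cV cW [V0 W0]; apply: filterI; [exact: cV|exact: cW].
    - move=> I f cf [i _ fi0]; apply: filterS (cf i fi0) => n fin.
      by exists i.
  move=> V [t [_ ct tV]] V0; apply: ct.
  by apply: open_nbhs_nbhs; split.
Qed.

(* Main.v *)
(** Let [H] be a countably infinite subgroup containing every [a n].  Adding
    the cosets of [H] to the topology of [P(G|{a_n})] keeps [a n] convergent
    to [0], so by maximality [H] is already [tau]-open.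

    If [sigma] is a Hausdorff paratopological group topology, choose
    [sigma]-neighbourhoods [U n] of [0] with [U n.+1 + U n.+1] inside [U n],
    such that the differences [U n - U n] have only [0] in common on [H].  The
    intersection [M] of all [U n - U n] is a [sigma]-closed subgroup; it meets
    each coset of [H] in at most one point, so it is also [tau]-closed and
    complementarity forces it to be finite.

    Take an infinite [E] in [H] with [H \ E] infinite.  Thinning [E] by a
    diagonal argument makes any two of its [sigma]-accumulation points differ
    by an element of [M], so that there are finitely many of them; the same
    argument for [tau], whose accumulation points of [E] stay in [H], leaves at
    most one.  Adding these finitely many points to the thinned [E] gives a set
    closed for both topologies, which is neither finite nor all of [G]. *)

Require Import Defs.
From mathcomp Require Import all_boot all_order all_algebra.
From mathcomp Require Import all_classical topology.

Set Implicit Arguments.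
Unset Strict Implicit.
Unset Printing Implicit Defensive.

Local Open Scope classical_set_scope.

(** * Selections from sequences of infinite sets *)

Section Diagonalization.

Lemma infinite_pick (T : Type) (D : set T) (s : set T) :
  infinite_set D -> finite_set s -> exists x, D x /\ ~ s x.
Proof.
move=> iD fs; have := infinite_setD iD fs.
by move=> /infinite_setN0 [x [Dx sx]]; exists x.
Qed.

(** Each term is picked outside the finite list [L n] of all earlier picks, which gives
    injectivity. *)
Lemma infinite_choice (T : choiceType) (D : nat -> set T) :
  (forall n, infinite_set (D n)) ->
  exists d : nat -> T, injective d /\ forall n, D n (d n).
Proof.
move=> iD.
have /choice[pick pickP] : forall p : nat * seq T,
    exists x, D p.1 x /\ ~ (x \in p.2).
  move=> [n s] /=; have [x [Dx sx]] := infinite_pick (iD n) (finite_seq s); by exists x.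
pose L := fix L n := if n is m.+1 then pick (m, L m) :: L m else [::].
exists (fun n => pick (n, L n)); split; last by move=> n; have [] := pickP (n, L n).
have inL m n : m < n -> pick (m, L m) \in L n.
  elim: n => // n IH; rewrite ltnS leq_eqVlt => /orP[/eqP ->|/IH mn] /=.
    by rewrite inE eqxx.
  by rewrite inE mn orbT.
move=> m n /= e; case: (ltngtP m n) => // mn.
  by have [_ /=] := pickP (n, L n); rewrite -e inL.
by have [_ /=] := pickP (m, L m); rewrite e inL.
Qed.

Lemma infinite_range (T : Type) (f : nat -> T) :
  injective f -> infinite_set (range f).
Proof.
move=> fi; rewrite (eq_finite_set (inj_card_eq _)); first exact: infinite_nat.
by move=> x y _ _; exact: fi.
Qed.

(** For an injective selection [d n] in the decreasing sets [D n], only the terms [d m] with [m < n]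
    can fall outside [D n]. *)
Lemma infinite_diagonal (T : choiceType) (D : nat -> set T) :
  (forall n, infinite_set (D n)) -> (forall n, D n.+1 `<=` D n) ->
  exists E, [/\ infinite_set E, E `<=` D 0 & forall n, finite_set (E `\` D n)].
Proof.
move=> iD Ddec; have [d [di Dd]] := infinite_choice iD.
have Dle m n : m <= n -> D n `<=` D m.
  move=> /subnK <-; elim: (n - m) => [|k IH]; first by rewrite add0n.
  by rewrite addSn; exact: subset_trans (Ddec _) IH.
exists (range d); split; first exact: infinite_range.
  by move=> _ [n _ <-]; exact: (Dle 0 n).
move=> n; apply: (@sub_finite_set _ _ (d @` `I_n)).
  move=> _ [[m _ <-] Dn]; exists m => //=; rewrite ltnNge; apply/negP => nm.
  by apply: Dn; exact: Dle (Dd m).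
by apply: finite_image; exact: finite_II.
Qed.

End Diagonalization.

(** * Separation, addition and accumulation in terms of open sets *)

Section ParatopologicalGroups.

Local Open Scope ring_scope.
Import GRing.Theory.

Lemma opens_local (X : Type) (t : topology X) (A : set X) :
  (forall x, A x -> exists U, [/\ opens t U, U x & U `<=` A]) -> opens t A.
Proof.
move=> At.
pose I := {U : set X | opens t U /\ U `<=` A}.
suff -> : A = \bigcup_(i : I) sval i.
  by apply: (top_bigU (opens_topology t)) => -[U []].
apply/seteqP; split=> [x /At[U [oU Ux UA]]|x [[U [oU UA]] _ /= /UA //]].
by exists (exist _ U (conj oU UA)).
Qed.

Lemma opensI (X : Type) (t : topology X) (A B : set X) :
  opens t A -> opens t B -> opens t (A `&` B).
Proof. exact: (topI (opens_topology t)). Qed.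

Lemma add_is_continuousP (G : zmodType) (t : topology G) :
  add_is_continuous t <->
  forall U x y, opens t U -> U (x + y) -> exists P Q,
    [/\ opens t P /\ opens t Q, P x, Q y &
        forall u v, P u -> Q v -> U (u + v)].
Proof.
split=> [tc U x y oU Uxy|tc [x y] A].
  have nU : nbhs (x + y : with_topology t) U by apply: open_nbhs_nbhs; split.
  have [[P Q] [Px Qy] PQ] := tc (x, y) U nU.
  have := Px : nbhs (x : with_topology t) P.
  have := Qy : nbhs (y : with_topology t) Q.
  rewrite !nbhsE => -[Q' [oQ' Q'y] Q'Q] [P' [oP' P'x] P'P].
  exists P', Q'; split => // u v P'u Q'v.
  by apply: (PQ (u, v)); split; [exact: P'P|exact: Q'Q].
move=> nA; have : nbhs (x + y : with_topology t) A by [].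
rewrite nbhsE => -[U [oU Uxy] UA].
have [P [Q [[oP oQ] Px Qy PQ]]] := tc U x y oU Uxy.
exists (P, Q) => /=; first by split; apply: open_nbhs_nbhs; split.
by move=> [u v] [/= Pu Qv]; apply: UA; exact: PQ.
Qed.

Lemma converges_toP (X : choiceType) (t : topology X) (a : nat -> X) l :
  converges_to t a l <->
  forall U, opens t U -> U l -> \forall n \near \oo, U (a n).
Proof.
split=> [ta U oU Ul|ta A]; first by apply: ta; apply: open_nbhs_nbhs; split.
rewrite nbhsE => -[U [oU Ul] UA].
by apply: filterS (ta U oU Ul) => n; exact: UA.
Qed.

Lemma is_T1P (X : choiceType) (t : topology X) :
  is_T1 t <-> forall x y, x <> y -> exists U, [/\ opens t U, U x & ~ U y].
Proof.
split=> [t1 x y /eqP xy|t1 x y /eqP xy].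
  by have [U [oU]] := t1 x y xy; rewrite !inE => Ux Uy; exists U.
by have [U [oU Ux Uy]] := t1 x y xy; exists U; rewrite !inE.
Qed.

Definition separates_points (X : Type) (t : topology X) : Prop :=
  forall x y, x <> y -> exists A B,
    [/\ opens t A /\ opens t B, A x, B y & forall z, A z -> ~ B z].

Lemma hausdorff_separates_points (X : choiceType) (t : topology X) :
  is_hausdorff t -> separates_points t.
Proof.
move=> th x y xy; apply: contrapT => nsep; apply: xy.
apply: (th x y) => A B.
rewrite !nbhsE => -[A' [oA A'x] A'A] [B' [oB B'y] B'B].
apply: contrapT => AB0; apply: nsep; exists A', B'; split => // z A'z B'z.
by apply: AB0; exists z; split; [exact: A'A|exact: B'B].
Qed.

(** Take [P + Q] inside a neighbourhood [U] of [x - y] missing [0]: a common point [z] of [P] and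
    [-Q] would put [z - z] in [U]. *)
Lemma T1_group_separates_points (G : zmodType) (t : topology G) :
  group_topology t -> separates_points t.
Proof.
move=> [[/is_T1P t1 /add_is_continuousP tc] /continuousP to] x y xy.
have [U [oU Uxy U0]] : exists U, [/\ opens t U, U (x - y) & ~ U 0].
  by apply: t1 => /eqP; rewrite subr_eq0 => /eqP.
have [P [Q [[oP oQ] Px Qy PQ]]] := tc _ x (- y) oU Uxy.
exists P, ((fun z : G => - z) @^-1` Q); split => //.
  by split => //; exact: (to Q oQ).
by move=> z Pz Qz; apply: U0; rewrite -(subrr z); exact: PQ.
Qed.

Definition accumulation_points (X : Type) (t : topology X) (D : set X) :
    set X :=
  [set y | forall U, opens t U -> U y -> infinite_set (U `&` D)].

Lemma subset_accumulation_points (X : Type) (t : topology X) (D E : set X) :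
  D `<=` E -> accumulation_points t D `<=` accumulation_points t E.
Proof.
move=> DE y Dy U oU Uy; apply: sub_infinite_set (Dy U oU Uy).
exact: setIS.
Qed.

(** A point outside has a neighbourhood meeting [D] in a finite set; removing that set and [P] keeps
    it open, since finite sets are closed. *)
Lemma closed_adjoin (X : Type) (t : topology X) (D P : set X) :
  (forall F, finite_set F -> opens t (~` F)) ->
  finite_set P -> accumulation_points t D `<=` P -> opens t (~` (D `|` P)).
Proof.
move=> tcof finP DP; apply: opens_local => y Fy.
have : ~ accumulation_points t D y by move=> /DP Py; apply: Fy; right.
move=> /existsNP[U] /not_implyP[oU] /not_implyP[Uy] /contrapT finUD.
exists (U `&` ~` ((U `&` D) `|` P)); split.
- by apply: opensI => //; apply: tcof; rewrite finite_setU.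
- by split => // -[[_ Dy]|Py]; apply: Fy; [left|right].
- by move=> z [Uz nz] [Dz|Pz]; apply: nz; [left|right].
Qed.

(** * Halving sequences of neighbourhoods and their cores *)

Definition difference_set (G : zmodType) (U : set G) : set G :=
  [set u - v | u in U & v in U].

(** Inversion may be discontinuous, so symmetry of [U n] is not asked for; [core] uses the
    differences [U n - U n] instead. *)
Definition halving (G : zmodType) (t : topology G) (U : nat -> set G) : Prop :=
  forall n, [/\ opens t (U n), U n 0 &
    forall x y, U n.+1 x -> U n.+1 y -> U n (x + y)].

Definition core (G : zmodType) (U : nat -> set G) : set G :=
  \bigcap_n difference_set (U n).

Section Paratopological.

Variables (G : zmodType) (t : topology G).
Hypothesis tc : add_is_continuous t.

Lemma opens_translate (U : set G) (g : G) :
  opens t U -> opens t [set x | U (g + x)].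
Proof.
move=> oU; apply: opens_local => x /= Ugx.
have [P [Q [[oP oQ] Pg Qx PQ]]] := (add_is_continuousP t).1 tc _ g x oU Ugx.
by exists Q; split => // z Qz; exact: PQ.
Qed.

Lemma neighbourhood_step (U : set G) (z : G) :
  separates_points t -> opens t U -> U 0 -> exists V,
    [/\ opens t V, V 0, forall x y, V x -> V y -> U (x + y) &
        z <> 0 -> ~ difference_set V z].
Proof.
move=> ts oU U0.
have [P [Q [[oP oQ] P0 Q0 PQ]]] : exists P Q,
    [/\ opens t P /\ opens t Q, P 0, Q 0 &
        forall u v, P u -> Q v -> U (u + v)].
  by apply: (add_is_continuousP t).1 => //; rewrite addr0.
have [->|z0] := eqVneq z 0.
  exists (P `&` Q); split => //; first exact: opensI.
  by move=> x y [Px _] [_ Qy]; exact: PQ.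
have [A [B [[oA oB] Az B0 AB]]] := ts z 0 (elimN eqP z0).
(* If [z = u - v] with [u] and [v] in this set, then [u = z + v] lies in both [A] and [B]. *)
exists ((P `&` Q) `&` (B `&` [set x | A (z + x)])); split.
- by do !apply: opensI => //; exact: opens_translate.
- by do !split => //=; rewrite addr0.
- by move=> x y [[Px _] _] [[_ Qy] _]; exact: PQ.
- move=> _ [u [_ [Bu _]]] [v [_ [_ /= Av]]] e.
  by apply: (AB u) => //; rewrite -(subrK v u) e.
Qed.

(** Stage [n] excludes the single point [c n], so the whole sequence excludes countably many
    points. *)
Lemma halving_exists (c : nat -> G) : separates_points t ->
  exists U, halving t U /\ forall n, c n <> 0 -> ~ core U (c n).
Proof.
move=> ts.
pose N := {U : set G | opens t U /\ U 0}.
have /choice[f fP] : forall p : N * nat, exists V : N,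
    (forall x y, sval V x -> sval V y -> sval p.1 (x + y)) /\
    (c p.2 <> 0 -> ~ difference_set (sval V) (c p.2)).
  move=> [[U [oU U0]] n] /=.
  have [V [oV V0 VU cV]] := neighbourhood_step (c n) ts oU U0.
  by exists (exist _ V (conj oV V0)).
pose W := fix W n : N := if n is m.+1 then f (W m, m)
  else exist _ setT (conj (topT (opens_topology t)) I).
exists (fun n => sval (W n)); split=> n.
  have [oW W0] := svalP (W n); split => //.
  exact: (fP (W n, n)).1.
by move=> /(fP (W n, n)).2 /= cW /(_ n.+1 I).
Qed.

Section Halving.

Variable U : nat -> set G.
Hypothesis hU : halving t U.

Lemma core_sub x y : core U x -> core U y -> core U (x - y).
Proof.
move=> cx cy n _; have [_ _ UD] := hU n.
have [u Uu [v Uv <-]] := cx n.+1 I.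
have [u' Uu' [v' Uv' <-]] := cy n.+1 I.
exists (u + v'); first exact: UD.
exists (v + u'); first exact: UD.
by rewrite opprB addrACA opprD.
Qed.

(** If [x] is outside [U n - U n], then [x + U n.+1] misses [U n.+1 - U n.+1]: from [x + w = u - v]
    follows [x = u - (v + w)]. *)
Lemma core_closed : opens t (~` core U).
Proof.
apply: opens_local => x /existsNP[n] /not_implyP[_ xn].
have [oU U0 _] := hU n.+1; have [_ _ UD] := hU n.
exists [set z | U n.+1 (- x + z)]; split => /=.
- exact: opens_translate.
- by rewrite addNr.
- move=> z Uxz /(_ n.+1 I)[u Uu [v Uv e]]; apply: xn.
  exists u; first by rewrite -(addr0 u); exact: UD.
  exists (v + (- x + z)); first exact: UD.
  by rewrite -e addrCA [v + _]addrC subrK opprD opprK addrCA subrr addr0.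
Qed.

(** Unless some infinite subset has no accumulation point, [E] can be shrunk successively into
    translates [x + U n] around accumulation points [x]; a diagonal set lies in each of them up to
    finitely many points. *)
Lemma thinning (E : set G) : infinite_set E ->
  exists D, [/\ infinite_set D, D `<=` E &
    forall y y', accumulation_points t D y -> accumulation_points t D y' ->
      core U (y - y')].
Proof.
move=> iE.
have [[D [iD DE Dacc]]|noD] := pselect (exists D, [/\ infinite_set D, D `<=` E &
    forall y, ~ accumulation_points t D y]).
  by exists D; split => // y y' /Dacc.
pose N := {D : set G | infinite_set D /\ D `<=` E}.
have /choice[f fP] : forall p : N * nat, exists D : N,
    sval D `<=` sval p.1 /\ exists x, forall z, sval D z -> U p.2 (- x + z).
  move=> [[D [iD DE]] n] /=.
  have [x Dx] : exists x, accumulation_points t D x.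
    by apply: contrapT => /forallNP nx; apply: noD; exists D.
  have [oU U0 _] := hU n.
  have iD' : infinite_set ([set z | U n (- x + z)] `&` D).
    by apply: Dx; [exact: opens_translate|rewrite /= addNr].
  have D'E : [set z | U n (- x + z)] `&` D `<=` E by move=> z [_ /DE].
  exists (exist _ ([set z | U n (- x + z)] `&` D) (conj iD' D'E)) => /=.
  by split; [exact: subIsetr|exists x => z []].
pose W := fix W n : N := if n is m.+1 then f (W m, m)
  else exist _ E (conj iE (@subset_refl _ E)).
have [D [iD DE DW]] := infinite_diagonal (D := fun n => sval (W n))
  (fun n => (svalP (W n)).1) (fun n => (fP (W n, n)).1).
exists D; split => // y y' Dy Dy' n _.
(* [W n.+2] is [f (W n.+1, n.+1)], hence contained in [x + U n.+1]. *)
have [x Ux] := (fP (W n.+1, n.+1)).2.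
have [oU U0 _] := hU n.+1; have [_ _ UD] := hU n.
have meet z : accumulation_points t D z -> exists w, U n.+1 (- x + w) /\
    U n.+1 (- z + w).
  move=> Dz; have iz : infinite_set ([set w | U n.+1 (- z + w)] `&` D).
    by apply: Dz; [exact: opens_translate|rewrite /= addNr].
  have [w [[Uw Dw] nw]] := infinite_pick iz (DW n.+2).
  exists w; split => //; apply: Ux; apply: contrapT => nWw.
  by apply: nw.
have [w [Uxw Uyw]] := meet y Dy; have [w' [Uxw' Uyw']] := meet y' Dy'.
(* In the difference of the two sums [x], [w] and [w'] cancel, leaving [y - y']. *)
exists ((- x + w) + (- y' + w')); first exact: UD.
exists ((- x + w') + (- y + w)); first exact: UD.
rewrite addrACA [- x + w' + _]addrACA [w' + w]addrC opprD [LHS]addrACA subrr addr0.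
by rewrite opprD !opprK addrACA addNr add0r addrC.
Qed.

End Halving.

End Paratopological.

(** * Countable subgroups and open subgroups *)

Lemma countable_subgroup (G : zmodType) (a : nat -> G) :
  exists (H : set G) (c : nat -> G),
    [/\ forall n, H (a n), H 0, forall x y, H x -> H y -> H (x - y) &
        H `<=` range c].
Proof.
(* Differences of finite sums of terms form the generated subgroup, and pairs of lists of naturals
   are enumerated by [unpickle]. *)
pose phi (s : seq nat * seq nat) := \sum_(i <- s.1) a i - \sum_(i <- s.2) a i.
exists (range phi), (fun n => oapp phi 0 (unpickle n)); split.
- by move=> n; exists ([:: n], [::]); rewrite /phi //= big_seq1 big_nil subr0.
- by exists ([::], [::]); rewrite /phi //= big_nil subr0.
- move=> _ _ [[s1 s2] _ <-] [[s3 s4] _ <-]; exists (s1 ++ s4, s2 ++ s3) => //.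
  by rewrite /phi /= !big_cat /= opprB opprD addrACA; congr (_ + _).
- by move=> _ [s _ <-]; exists (pickle s) => //; rewrite pickleK.
Qed.

Section OpenSubgroup.

Variables (G : zmodType) (H : set G).
Hypotheses (H0 : H 0) (HB : forall x y, H x -> H y -> H (x - y)).

Let HD x y : H x -> H y -> H (x + y).
Proof. by move=> Hx Hy; rewrite -[y]opprK -[- y]add0r; do !apply: HB. Qed.

(** The topology generated by [t] and the cosets of [H]. *)
Definition coset_opens (t : topology G) : set_system G :=
  [set A | forall x, A x ->
    exists T, [/\ opens t T, T x & forall z, T z -> H (z - x) -> A z]].

Lemma coset_opens_topology (t : topology G) : is_topology (coset_opens t).
Proof.
split.
- by move=> x _; exists setT; split => //; exact: topT (opens_topology t).
- move=> A B oA oB x [Ax Bx].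
  have [T [oT Tx TA]] := oA x Ax; have [S [oS Sx SB]] := oB x Bx.
  exists (T `&` S); split => //; first exact: opensI.
  by move=> z [Tz Sz] Hz; split; [exact: TA|exact: SB].
- move=> I f of_ x [i _ fix_]; have [T [oT Tx Tf]] := of_ i x fix_.
  by exists T; split => // z Tz Hz; exists i => //; exact: Tf.
Qed.

Lemma P_topology_open_subgroup (a : nat -> G) (tau : topology G) :
  is_P_topology a tau -> (forall n, H (a n)) -> opens tau H.
Proof.
move=> [[t1 tc] ta tmax] Ha.
pose t' := Topology (coset_opens_topology tau).
have tt' : opens tau `<=` opens t'.
  by move=> A oA x Ax; exists A; split.
suff : opens t' `<=` opens tau.
  apply=> x Hx; exists setT; split => //; first exact: topT (opens_topology tau).
  by move=> z _ Hzx; rewrite -(subrK x z); exact: HD.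
apply: tmax.
- split.
    apply/is_T1P => x y /((is_T1P tau).1 t1)[U [oU Ux Uy]].
    by exists U; split => //; exact: tt'.
  apply/add_is_continuousP => U x y oU Uxy.
  have [T [oT Txy TU]] := oU _ Uxy.
  have [P [Q [[oP oQ] Px Qy PQ]]] :=
    (add_is_continuousP tau).1 tc T x y oT Txy.
  have coset A (z : G) : opens tau A -> opens t' (A `&` [set w | H (w - z)]).
    move=> oA w [Aw Hwz]; exists A; split => // v Av Hvw; split => //=.
    by rewrite -(subrK w v) -addrA; exact: HD.
  exists (P `&` [set w | H (w - x)]), (Q `&` [set w | H (w - y)]); split.
  + by split; exact: coset.
  + by rewrite /= subrr.
  + by rewrite /= subrr.
  + move=> u v [Pu Hux] [Qv Hvy]; apply: TU; first exact: PQ.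
    by rewrite opprD addrACA; exact: HD.
- apply/converges_toP => U oU U0; have [T [oT T0 TU]] := oU 0 U0.
  apply: filterS ((converges_toP tau a 0).1 ta T oT T0) => n Tan.
  by apply: TU => //; rewrite subr0.
Qed.

(** An open subgroup is closed: if [y + H] meets [D], hence [H], then [y] is in [H]. *)
Lemma accumulation_points_subgroup (t : topology G) (D : set G) :
  add_is_continuous t -> opens t H -> D `<=` H ->
  accumulation_points t D `<=` H.
Proof.
move=> tc oH DH y Dy.
have iD : infinite_set ([set z | H (- y + z)] `&` D).
  by apply: Dy; [exact: opens_translate|rewrite /= addNr].
have [z [Hz /DH Hz']] := infinite_setN0 iD.
by have := HB Hz' Hz; rewrite opprD opprK addrCA subrr addr0.
Qed.

(** Two points of [M] in the open coset [y + H] differ by an element of both [M] and [H], so there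
    is at most one, and it can be removed. *)
Lemma sparse_subgroup_closed (t : topology G) (M : set G) :
  add_is_continuous t -> (forall F, finite_set F -> opens t (~` F)) ->
  opens t H -> (forall x y, M x -> M y -> M (x - y)) ->
  (forall x, M x -> H x -> x = 0) -> opens t (~` M).
Proof.
move=> tc tcof oH MB MH; apply: opens_local => y My.
pose V := [set z | H (- y + z)].
have oV : opens t V by exact: opens_translate.
have fVM : finite_set (V `&` M).
  have [->|/set0P[m [Vm Mm]]] := eqVneq (V `&` M) set0; first exact: finite_set0.
  apply: (@sub_finite_set _ _ [set m]) => [z [Vz Mz]|]; last exact: finite_set1.
  apply/eqP; rewrite -subr_eq0; apply/eqP; apply: MH; first exact: MB.
  by have := HB Vz Vm; rewrite opprD addrACA subrr add0r.
exists (V `&` ~` (V `&` M)); split.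
- by apply: opensI => //; exact: tcof.
- by split; [rewrite /V /= addNr|move=> [_ /My]].
- by move=> z [Vz nVM] Mz; apply: nVM.
Qed.

End OpenSubgroup.

Lemma finite_pairwise_differences (G : zmodType) (A M : set G) :
  finite_set M -> (forall x y, A x -> A y -> M (x - y)) -> finite_set A.
Proof.
move=> fM AM; have [->|/set0P[y Ay]] := eqVneq A set0; first exact: finite_set0.
apply: (@sub_finite_set _ _ ((fun m => m + y) @` M)); last exact: finite_image.
by move=> x Ax; exists (x - y); [exact: AM|rewrite subrK].
Qed.

End ParatopologicalGroups.

(** * An infinite proper set closed in both topologies *)

Theorem theorem5p20 (G : zmodType) (a : nat -> G) (tau : topology G)
    (infG : infinite_set [set: G]) (Ta : T_sequence a)
    (Ptau : is_P_topology a tau) :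
  ~ exists sigma : topology G,
      [/\ paratopological_group_topology sigma, is_hausdorff sigma &
          T1_complementary sigma tau].
Proof.
move=> [sigma [[_ sc] /hausdorff_separates_points sh [_ _ cof _]]].
have [[_ tc] _ tmax] := Ptau.
(* [tau] refines the group topology supplied by [Ta], which is Hausdorff. *)
have th : separates_points tau.
  have [t0 [gt0 ct0]] := Ta; move=> x y xy.
  have [A [B [[oA oB] Ax By AB]]] := T1_group_separates_points gt0 xy.
  by exists A, B; split => //; split; apply: (tmax t0) => //; exact: gt0.1.
have closed_both F : opens sigma (~` F) -> opens tau (~` F) ->
    F = setT \/ finite_set F.
  move=> sF tF; have : cofinite_opens (~` F) by rewrite -cof.
  by case; rewrite ?setCK; [move=> F0; left; rewrite -(setCK F) F0 setC0|right].
have cof_open F : finite_set F -> opens sigma (~` F) /\ opens tau (~` F).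
  move=> fF; suff : (opens sigma `&` opens tau) (~` F) by [].
  by rewrite cof; right; rewrite setCK.
have cofs F : finite_set F -> opens sigma (~` F) by move=> /cof_open[].
have coft F : finite_set F -> opens tau (~` F) by move=> /cof_open[].
have [f [fi _]] := infinite_choice (D := fun=> [set: G]) (fun=> infG).
(* Interleaving [a] with the injective [f] makes one countable subgroup contain all [a n] and be
   infinite. *)
pose g n := if odd n then a n./2 else f n./2.
have [H [c [Hg H0 HB Hc]]] := countable_subgroup g.
have Ha n : H (a n) by have := Hg n.*2.+1; rewrite /g /= odd_double uphalf_double.
have Hf n : H (f n) by have := Hg n.*2; rewrite /g odd_double doubleK.
have oH := P_topology_open_subgroup H0 HB Ptau Ha.
have Hcore U : (forall n, c n <> 0%R -> ~ core U (c n)) ->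
    forall x, core U x -> H x -> x = 0%R.
  move=> Uc x Ux Hx; apply: contrapT => x0.
  by have [n _ nx] := Hc x Hx; apply: (Uc n); rewrite nx.
have [U [hU /Hcore UH]] := halving_exists sc c sh.
have [W [hW /Hcore WH]] := halving_exists tc c th.
have finM : finite_set (core U).
  have [||MT|//] := closed_both (core U).
  - exact: core_closed hU.
  - exact: (sparse_subgroup_closed H0 HB tc coft oH (core_sub hU) UH).
  (* A core equal to [G] would meet [H] only in [0], making the injective [f] constant. *)
  - have fx n : f n = 0%R by apply: UH (Hf n); rewrite MT.
    by have /fi : f 0 = f 1 by rewrite !fx.
(* Only even indices are used; the odd ones will witness that the final set is not [G]. *)
pose E := range (f \o double).
have iE : infinite_set E.
  by apply: infinite_range => m n /= /fi /double_inj.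
have EH : E `<=` H by move=> _ [n _ <-]; exact: Hf.
have [D1 [iD1 D1E accD1]] := thinning tc hW iE.
(* The second thinning preserves the first: passing to [D2] adds no [tau]-accumulation point. *)
have [D2 [iD2 D2D1 accD2]] := thinning sc hU iD1.
have fin_tau : finite_set (accumulation_points tau D1).
  apply: (finite_pairwise_differences (finite_set1 0%R)) => x y Dx Dy.
  have D1H := accumulation_points_subgroup H0 HB tc oH (subset_trans D1E EH).
  by apply: WH; [exact: accD1|apply: HB; exact: D1H].
have fin_sigma := finite_pairwise_differences finM accD2.
pose P := accumulation_points tau D1 `|` accumulation_points sigma D2.
have fP : finite_set P by rewrite finite_setU.
have [||FT|] := closed_both (D2 `|` P).
- by apply: (closed_adjoin cofs fP) => y Dy; right.
- apply: (closed_adjoin coft fP).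
  by move=> y /(subset_accumulation_points D2D1) Dy; left.
(* If [D2] and [P] covered [G], the infinitely many odd-indexed [f n], which avoid [D2], would all
   lie in the finite [P]. *)
- have : infinite_set (range (f \o S \o double)).
    by apply: infinite_range => m n /= /fi [] /double_inj.
  apply; apply: sub_finite_set fP => _ [n _ <-].
  have : (D2 `|` P) (f n.*2.+1) by rewrite FT.
  case=> // /D2D1 /D1E [m _ /= /fi e].
  by have := congr1 odd e; rewrite /= !odd_double.
- by rewrite finite_setU => -[].
Qed.
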